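(* Let $\eta_0,\ldots,\eta_J$ be random variables on $(\widetilde\Omega,\widetilde{\mathcal F},\widetilde{\mathsf P})$ with $\widetilde{\mathsf E}_{\mathcal F}[\eta_j]=0$ for $j=0,\ldots,J$, let $\mathcal S=(\mathcal S_j)_{0\le j\le J}$ be a martingale with respect to $(\mathcal F_j)$ with $\mathcal S_0=0$, and put $\widetilde M_j=M_j^{\star}-\mathcal S_j-\eta_j$. Then $$\widetilde{\mathsf E}\left[\max_{0\le j\le J}(Z_j-\widetilde M_j)\right]\ge Y_0^{\star}.$$ If $\mathcal S=0$, that is $\widetilde M_j=M_j^{\star}-\eta_j$, and the random perturbations $(\eta_j)$ satisfy in addition $$\eta_j\le Y_j^{\star}-Z_j+A_j^{\star}\quad\widetilde{\mathsf P}\text{-a.s.},\quad j=0,\ldots,J,\qquad( * )$$ then one has the almost sure identity $$Y_0^{\star}=\max_{0\le j\le J}(Z_j-\widetilde M_j)\quad\widetilde{\mathsf P}\text{-a.s.}$$ Moreover (under $( * )$), for the first optimal stopping time $\tau^{\star}$ one must have $\eta_{\tau^{\star}}=0$ a.s., and if $\tau^{\star}$ is strict in the sense that $Y^{\star}_{\tau^{\star}}-\mathsf E_{\mathcal F_{\tau^{\star}}}[Y^{\star}_{\tau^{\star}+1}]>0$, then $j=\tau^{\star}$ is the only time $j$ where $\eta_j=0$.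
   Context: $J\in\mathbb N_+$; $(\Omega,\mathcal F,\mathsf P)$ is a probability space with discrete filtration $(\mathcal F_j)_{0\le j\le J}$, $\mathcal F_0$ being $\mathsf P$-trivial (so that $Y_0^\star$ below is deterministic); $\mathsf E_{\mathcal F_j}$ denotes conditional expectation given $\mathcal F_j$. The reward process $Z=(Z_j)_{0\le j\le J}$ is real-valued, adapted and integrable. The Snell envelope is $Y_j^{\star}=\operatorname{ess\,sup}_{\tau\in\mathcal T[j,\ldots,J]}\mathsf E_{\mathcal F_j}[Z_\tau]$, where $\mathcal T[j,\ldots,J]$ is the set of stopping times with values in $\{j,\ldots,J\}$; put $Y_{J+1}^{\star}:=0$. Its Doob decomposition is $Y_j^{\star}=Y_0^{\star}+M_j^{\star}-A_j^{\star}$ with $M^{\star}_j=\sum_{l=1}^{j}\left(Y_l^{\star}-\mathsf E_{\mathcal F_{l-1}}[Y_l^{\star}]\right)$ (the Doob martingale, $M_0^\star=0$) and $A_j^{\star}=\sum_{l=1}^{j}\left(Y_{l-1}^{\star}-\mathsf E_{\mathcal F_{l-1}}[Y_l^{\star}]\right)$ (predictable, non-decreasing, $A_0^\star=0$). The first optimal stopping time is $\tau^{\star}=\inf\{0\le i\le J: Z_i\ge\mathsf E_{\mathcal F_i}[Y_{i+1}^{\star}]\}$, with $\tau^\star=J$ if no such $i<J$ exists. $(\Omega_0,\mathcal B)$ is an auxiliary measurable space that is ''rich enough'', $\widetilde\Omega=\Omega\times\Omega_0$, $\widetilde{\mathcal F}=\sigma\{F\times B:F\in\mathcal F,B\in\mathcal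 B\}$, and $\widetilde{\mathsf P}$ is a probability measure on $(\widetilde\Omega,\widetilde{\mathcal F})$ extending $\mathsf P$, i.e. $\widetilde{\mathsf P}(F\times\Omega_0)=\mathsf P(F)$ for all $F\in\mathcal F$. $\mathcal F$ and $\mathcal F_j$ are identified with $\{F\times\Omega_0:F\in\mathcal F\}$ and $\{F\times\Omega_0:F\in\mathcal F_j\}$, and random variables on $\Omega$ are regarded as random variables on $\widetilde\Omega$ not depending on $\omega_0\in\Omega_0$. $\widetilde{\mathsf E}$ is expectation and $\widetilde{\mathsf E}_{\mathcal F}$ conditional expectation given (the identified) $\mathcal F$ under $\widetilde{\mathsf P}$.
   Formalization: The last clause is false for a given η (η=0 satisfies ( * )); it is read as: any random time at which every centered η with ( * ) must vanish a.s. equals τ* a.s., with ''rich enough'' meaning that some event of probability in (0,1) is independent of F. *)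

(* Defs.v *)
From HB Require Import structures.
From mathcomp Require Import all_boot all_order all_algebra.
From mathcomp Require Import all_classical all_reals all_analysis.

Set Implicit Arguments.
Unset Strict Implicit.
Unset Printing Implicit Defensive.

Import Order.TTheory GRing.Theory Num.Theory.
Import numFieldNormedType.Exports.

Local Open Scope classical_set_scope.
Local Open Scope ring_scope.

(* Objects that are only determined up to null sets (conditional expectations,
   essential suprema) are described by predicates "W is a version of ..."; the
   theorem is stated for an arbitrary choice of versions. *)

Section conditional_expectation.
Context {d : measure_display} {T : measurableType d} {R : realType}.
Implicit Types (P : probability T R) (G : set (set T)) (X W : T -> R).

Definition sub_sigma_algebra G : Prop :=
  sigma_algebra setT G /\ G `<=` measurable.

(* Measurability with respect to <<s G>>, which is G when G is a
   sigma-algebra. *)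
Definition measurable_wrt G X : Prop :=
  measurable_fun [set: g_sigma_algebraType G] (X : g_sigma_algebraType G -> R).

Definition is_condexp P G X W : Prop :=
  [/\ P.-integrable setT (EFin \o X),
      measurable_wrt G W,
      P.-integrable setT (EFin \o W) &
      forall A, G A ->
        (\int[P]_(w in A) (W w)%:E = \int[P]_(w in A) (X w)%:E)%E].

Definition is_ess_sup P (Phi : set (T -> R)) (Y : T -> R) : Prop :=
  [/\ measurable_fun setT Y,
      forall X, Phi X -> \forall w \ae P, X w <= Y w &
      forall V : T -> R, measurable_fun setT V ->
        (forall X, Phi X -> \forall w \ae P, X w <= V w) ->
        \forall w \ae P, Y w <= V w].

End conditional_expectation.

Section discrete_time.
Context {d : measure_display} {T : measurableType d} {R : realType}.
Variables (P : probability T R) (F : nat -> set (set T)) (J : nat).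

(* All families below are indexed by nat, but only indices in {0, ..., J}
   (or J.+1 for the Snell envelope) are meaningful and constrained. *)

Definition filtration : Prop :=
  (forall j, (j <= J)%N -> sub_sigma_algebra (F j)) /\
  (forall i j, (i <= j <= J)%N -> F i `<=` F j).

Definition trivial_sigma_algebra (G : set (set T)) : Prop :=
  forall A, G A -> P A = 0%E \/ P A = 1%E.

Definition adapted (X : nat -> T -> R) : Prop :=
  forall j, (j <= J)%N -> measurable_wrt (F j) (X j).

Definition integrable_process (X : nat -> T -> R) : Prop :=
  forall j, (j <= J)%N -> P.-integrable setT (EFin \o X j).

Definition martingale (S : nat -> T -> R) : Prop :=
  [/\ adapted S, integrable_process S &
      forall j, (j < J)%N -> is_condexp P (F j) (S j.+1) (S j)].

(* tau belongs to T[j, ..., J]. *)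
Definition stopping_time (j : nat) (tau : T -> nat) : Prop :=
  (forall w, (j <= tau w <= J)%N) /\
  (forall k, (k <= J)%N -> F k [set w | (tau w <= k)%N]).

Definition snell_envelope (Z Y : nat -> T -> R) : Prop :=
  [/\ adapted Y,
      forall j, (j <= J)%N ->
        is_ess_sup P
          [set W | exists2 tau, stopping_time j tau &
                     is_condexp P (F j) (fun w => Z (tau w) w) W]
          (Y j) &
      forall w, Y J.+1 w = 0].

(* C j is a version of the conditional expectation of Y j.+1 given F j. *)
Definition continuation_value (Y C : nat -> T -> R) : Prop :=
  forall j, (j <= J)%N -> is_condexp P (F j) (Y j.+1) (C j).

End discrete_time.

Section doob.
Context {T : Type} {R : realType}.
Implicit Types (Y C Z : nat -> T -> R).

Definition doob_martingale Y C (j : nat) (w : T) : R :=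
  \sum_(l < j) (Y l.+1 w - C l w).

Definition doob_compensator Y C (j : nat) (w : T) : R :=
  \sum_(l < j) (Y l w - C l w).

(* [find] returns the length J of the list [0, ..., J-1] when no index
   satisfies the predicate. *)
Definition first_optimal_time (J : nat) Z C (w : T) : nat :=
  find (fun i => C i w <= Z i w) (iota 0 J).

(* The seed x 0 is itself one of the terms, so this is the plain maximum. *)
Definition max_upto (J : nat) (x : nat -> R) : R :=
  \big[Num.max/x 0%N]_(j < J.+1) x j.

End doob.

Section extension.
Context {d d0 : measure_display} {T : measurableType d}
  {T0 : measurableType d0} {R : realType}.
Variables (P : probability T R) (Pt : probability (T * T0)%type R) (J : nat).

Definition extends : Prop :=
  forall A : set T, measurable A -> Pt (A `*` setT) = P A.

(* The copy of the sigma-algebra of T in the product space. *)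
Definition lifted_sigma_algebra : set (set (T * T0)) :=
  [set A `*` setT | A in (measurable : set (set T))].

Definition centered (eta : nat -> T * T0 -> R) : Prop :=
  forall j, (j <= J)%N ->
    is_condexp Pt lifted_sigma_algebra (eta j) (fun=> 0).

(* Y is the Snell envelope of Z and A its Doob compensator. *)
Definition perturbation_bound (Z Y A : nat -> T -> R)
    (eta : nat -> T * T0 -> R) : Prop :=
  forall j, (j <= J)%N ->
    \forall w \ae Pt, eta j w <= Y j w.1 - Z j w.1 + A j w.1.

(* A minimal form of "rich enough": the extension carries some nondegenerate
   event independent of the original sigma-algebra. *)
Definition rich_enough : Prop :=
  exists G : set (T * T0),
    [/\ measurable G, (0 < Pt G)%E, (Pt G < 1)%E &
        forall A : set T, measurable A ->
          Pt (G `&` (A `*` setT)) = (Pt G * P A)%E].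

Definition random_time (sigma : T * T0 -> nat) : Prop :=
  measurable_fun setT sigma /\ forall w, (sigma w <= J)%N.

(* Every admissible family of perturbations has to vanish at time sigma. *)
Definition forced_zero (Z Y A : nat -> T -> R) (sigma : T * T0 -> nat) : Prop :=
  forall eta : nat -> T * T0 -> R,
    centered eta -> perturbation_bound Z Y A eta ->
    \forall w \ae Pt, eta (sigma w) w = 0.

End extension.

(* Main.v *)
(* Backward induction gives the Bellman equation Y_j = max(Z_j, C_j), Y_J = Z_J:
   integrating over events of F_j, the first optimal time attains the right-hand
   side and every other stopping time stays below it, so that no conditional
   expectation has to be constructed.  Hence, pathwise,
   Z_j - M_j = Y_0 - D_j with D_j = Y_j - Z_j + A_j >= 0 and D_tau = 0.
   Evaluating the maximum at tau gives Y_0 + S_tau + eta_tau, whose mean is Y_0 by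
   optional stopping.  Under eta_j <= D_j the maximum is at most Y_0, and
   eta_tau <= D_tau = 0 has mean 0, so it vanishes.  In the strict case D_j > 0 for
   j <> tau; with G independent of the original sigma-algebra, the perturbations
   (1_G - Pt G) min(1, D_j) are admissible and vanish only where D_j = 0. *)

Require Import Defs.
From HB Require Import structures.
From mathcomp Require Import all_boot all_order all_algebra.
From mathcomp Require Import all_classical all_reals all_analysis.
From mathcomp Require Import measurable_realfun lra.

Set Implicit Arguments.
Unset Strict Implicit.
Unset Printing Implicit Defensive.

Import Order.TTheory GRing.Theory Num.Theory.
Import numFieldNormedType.Exports.

Local Open Scope classical_set_scope.
Local Open Scope ring_scope.

(** * Integration: splitting, almost-everywhere comparison, sampling at a random index *)

Section integrals.
Context d (T : measurableType d) (R : realType) (mu : {measure set T -> \bar R}).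

Lemma integral_setID (A B : set T) (f : T -> \bar R) :
  measurable A -> measurable B -> measurable_fun A f ->
  (\int[mu]_(x in A) f x =
   \int[mu]_(x in A `&` B) f x + \int[mu]_(x in A `\` B) f x)%E.
Proof.
move=> mA mB mf; rewrite -integral_setU ?setUIDK//.
- exact: measurableI.
- exact: measurableD.
- apply/disj_setPS => x [[_ Bx] [_]]; exact.
Qed.

(** Inside [B] the restricted measure agrees with [mu], outside it is the zero measure; splitting
    [A] along [B] leaves only the inner part. *)
Lemma integral_mrestr (A B : set T) (mB : measurable B) (f : T -> \bar R) :
  measurable A -> measurable_fun A f ->
  (\int[mrestr mu mB]_(x in A) f x = \int[mu]_(x in A `&` B) f x)%E.
Proof.
move=> mA mf; transitivity (\int[mrestr mu mB]_(x in A `&` B) f x +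
    \int[mrestr mu mB]_(x in A `\` B) f x)%E.
  rewrite -integral_setU ?setUIDK//.
  - exact: measurableI.
  - exact: measurableD.
  - apply/disj_setPS => x [[_ Bx] [_]]; exact.
rewrite (eq_measure_integral mu) => [|E mE EAB]; last first.
  by rewrite /= /mrestr setIidl// => x /EAB[].
rewrite [X in (_ + X)%E](eq_measure_integral mzero) => [|E mE EAB]; last first.
  rewrite /= /mrestr (_ : E `&` B = set0) ?measure0//.
  by apply/seteqP; split=> // x [/EAB[_]].
by rewrite integral_measure_zero adde0.
Qed.

(** The pointwise maximum of [f] and [g] equals [g] almost everywhere and dominates [f] everywhere,
    so ordinary monotonicity applies to it. *)
Lemma ae_le_integral (A : set T) (f g : T -> \bar R) : measurable A ->
  mu.-integrable A f -> mu.-integrable A g ->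
  (\forall x \ae mu, A x -> (f x <= g x)%E) ->
  (\int[mu]_(x in A) f x <= \int[mu]_(x in A) g x)%E.
Proof.
move=> mA fi gi fg; have mf := measurable_int _ fi.
have mg := measurable_int _ gi.
have mfg : measurable_fun A (fun x => maxe (f x) (g x)) by exact: measurable_maxe.
have gE : ae_eq mu A g (fun x => maxe (f x) (g x)).
  by apply: filterS fg => x /[apply] /max_idPr.
rewrite (ae_eq_integral _ _ mA mg mfg gE); apply: le_integral => //.
  apply/integrableP; split => //.
  have := (integrableP _ _ _ gi).2; congr (_ < _)%E; apply: ae_eq_integral => //.
  - exact: measurableT_comp.
  - exact: measurableT_comp.
  - exact: ae_eq_abse.
by move=> x _; rewrite le_max lexx.
Qed.

(** On the test set [E] the difference [f - g] is positive but has integral at most 0, hence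
    vanishes almost everywhere there; so [E] is null. *)
Lemma ae_le_of_integral_le (f g : T -> R) :
  mu.-integrable setT (EFin \o f) -> mu.-integrable setT (EFin \o g) ->
  (\int[mu]_(x in [set x | (g x < f x)%R]) (f x)%:E <=
   \int[mu]_(x in [set x | (g x < f x)%R]) (g x)%:E)%E ->
  \forall x \ae mu, f x <= g x.
Proof.
move=> fi gi; set E := [set x | _] => fg.
have mf : measurable_fun setT f by apply/measurable_EFinP; exact: measurable_int fi.
have mg : measurable_fun setT g by apply/measurable_EFinP; exact: measurable_int gi.
have mE : measurable E.
  have := measurable_fun_ltr mg mf measurableT; move/(_ [set true]).
  by rewrite setTI; apply.
have fiE : mu.-integrable E (EFin \o f) by exact: integrableS fi.
have giE : mu.-integrable E (EFin \o g) by exact: integrableS gi.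
have ge0 x : E x -> (0 <= (f x)%:E - (g x)%:E)%E.
  by move=> /= /ltW fx; rewrite -EFinB lee_fin subr_ge0.
have I0 : (\int[mu]_(x in E) `|(f x)%:E - (g x)%:E| = 0)%E.
  transitivity (\int[mu]_(x in E) ((f x)%:E - (g x)%:E))%E.
    by apply: eq_integral => x /set_mem /ge0; exact: gee0_abs.
  apply/eqP; rewrite eq_le integral_ge0// andbT integralB_EFin// sube_le0//.
have : ae_eq mu E (fun x => (f x)%:E - (g x)%:E)%E (cst 0%E).
  apply/ae_eq_integral_abs => //.
  apply: measurable_funS measurableT _ _ => //.
  by apply/measurable_EFinP; exact: measurable_funB.
apply: filterS => x xE; rewrite leNgt; apply/negP => /[dup] /xE.
by rewrite -EFinB => -[/eqP]; rewrite subr_eq0 => /eqP ->; rewrite ltxx.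
Qed.

Lemma ae_eq0_of_le0_integral0 (f : T -> R) :
  mu.-integrable setT (EFin \o f) -> (\forall x \ae mu, f x <= 0) ->
  (\int[mu]_x (f x)%:E = 0)%E -> \forall x \ae mu, f x = 0.
Proof.
move=> fi f0 If0; have mf := measurable_int _ fi.
have : ae_eq mu setT (EFin \o f) (cst 0%E).
  apply/ae_eq_integral_abs => //.
  transitivity (\int[mu]_x (- (f x)%:E))%E.
    apply: ae_eq_integral => //; [exact: measurableT_comp|exact: measurableT_comp|].
    by apply: filterS f0 => x fx _ /=; rewrite ler0_norm.
  by rewrite integralN ?If0 ?oppe0//; exact: integrable_add_def.
by apply: filterS => x /(_ I) -[].
Qed.

Lemma integrable_maxr (f g : T -> R) :
  mu.-integrable setT (EFin \o f) -> mu.-integrable setT (EFin \o g) ->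
  mu.-integrable setT (EFin \o (fun x => Num.max (f x) (g x))).
Proof.
move=> fi gi; apply: (le_integrable measurableT _ _
    (integrableD measurableT (integrable_abse fi) (integrable_abse gi))).
  apply/measurable_EFinP/measurable_maxr; apply/measurable_EFinP.
  - exact: measurable_int fi.
  - exact: measurable_int gi.
move=> x _ /=; rewrite lee_fin [leRHS]ger0_norm ?addr_ge0//.
by rewrite /Num.max; case: ifP => _; rewrite ?lerDl ?lerDr.
Qed.

Lemma integrable_bigmaxr I (s : seq I) (f0 : T -> R) (f : I -> T -> R) :
  mu.-integrable setT (EFin \o f0) ->
  (forall i, mu.-integrable setT (EFin \o f i)) ->
  mu.-integrable setT (EFin \o (fun x => \big[Num.max/f0 x]_(i <- s) f i x)).
Proof.
move=> f0i fi; elim: s => [|i s IH].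
  by apply: eq_integrable f0i => // x _ /=; rewrite big_nil.
apply: eq_integrable (integrable_maxr (fi i) IH) => // x _ /=.
by rewrite big_cons.
Qed.

Section random_index.
Variables (J : nat) (sigma : T -> nat) (X : nat -> T -> R).
Hypotheses (sigmaJ : forall x, (sigma x <= J)%N)
  (msigma : forall k, (k <= J)%N -> measurable [set x | sigma x = k])
  (Xi : forall k, (k <= J)%N -> mu.-integrable setT (EFin \o X k)).

(** Exactly one level set of [sigma] contains [x], so a single summand survives; integrals at a
    random index thereby reduce to fixed indices. *)
Let XsigmaE x : ((X (sigma x) x)%:E =
  \sum_(k < J.+1) ((EFin \o X k) \_ [set y | sigma y = k]) x)%E.
Proof.
have sx : (sigma x < J.+1)%N by rewrite ltnS.
rewrite (bigD1 (Ordinal sx))//= patchE mem_set//= big1 ?adde0// => k kx.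
rewrite patchE memNset//= => xk; move: kx.
by rewrite -(inj_eq val_inj)/= xk eqxx.
Qed.

Let restr_integrable (k : 'I_J.+1) :
  mu.-integrable setT ((EFin \o X k) \_ [set y | sigma y = k]).
Proof.
have kJ : (k <= J)%N by rewrite -ltnS.
apply/(integrable_mkcond _ (msigma kJ)).
by apply: integrableS (Xi kJ) => //; exact: (msigma kJ).
Qed.

Lemma integrable_random_index :
  mu.-integrable setT (EFin \o (fun x => X (sigma x) x)).
Proof.
rewrite (_ : _ \o _ = fun x => \sum_(k < J.+1)
    ((EFin \o X k) \_ [set y | sigma y = k]) x)%E; last exact/funext.
by apply: integrable_sum => // k _.
Qed.

Lemma integral_random_index :
  (\int[mu]_x (X (sigma x) x)%:E =
   \sum_(k < J.+1) \int[mu]_(x in [set y | sigma y = k]) (X k x)%:E)%E.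
Proof.
under eq_integral do rewrite XsigmaE.
rewrite integral_sum//; apply: eq_bigr => k _.
by rewrite -integral_mkcond.
Qed.

End random_index.

End integrals.

(** * Sub-sigma-algebras and comparison of functions measurable for them *)

Section sub_sigma_algebra.
Context d (T : measurableType d) (R : realType) (P : probability T R).
Variable G : set (set T).
Hypothesis hG : Defs.sub_sigma_algebra G.

Let measurableG : G.-sigma.-measurable = G.
Proof. exact: measurable_g_measurableTypeE hG.1. Qed.

Lemma sub_sigmaT : G setT.
Proof. by rewrite -measurableG; exact: measurableT. Qed.

Lemma sub_sigmaD A B : G A -> G B -> G (A `\` B).
Proof. by rewrite -measurableG; exact: measurableD. Qed.

Lemma sub_sigmaU A B : G A -> G B -> G (A `|` B).
Proof. by rewrite -measurableG; exact: measurableU. Qed.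

Lemma measurable_wrt_measurable (X : T -> R) :
  measurable_wrt G X -> measurable_fun setT X.
Proof.
move=> mX _ B mB; rewrite setTI; apply: hG.2.
rewrite -measurableG -[X in measurable X]setTI.
exact: mX.
Qed.

Lemma measurable_wrt_lt (X Y : T -> R) :
  measurable_wrt G X -> measurable_wrt G Y -> G [set x | X x < Y x].
Proof.
move=> mX mY; rewrite -measurableG.
have := measurable_fun_ltr mX mY measurableT; move/(_ [set true]).
by rewrite setTI; apply.
Qed.

Lemma measurable_wrt_le (X Y : T -> R) :
  measurable_wrt G X -> measurable_wrt G Y -> G [set x | X x <= Y x].
Proof.
move=> mX mY; rewrite -measurableG.
have := measurable_fun_ler mX mY measurableT; move/(_ [set true]).
by rewrite setTI; apply.
Qed.

Lemma ae_le_of_sub_sigma_integral (X Y : T -> R) :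
  measurable_wrt G X -> measurable_wrt G Y ->
  P.-integrable setT (EFin \o X) -> P.-integrable setT (EFin \o Y) ->
  (forall A, G A ->
    (\int[P]_(w in A) (X w)%:E <= \int[P]_(w in A) (Y w)%:E)%E) ->
  \forall w \ae P, X w <= Y w.
Proof.
move=> mX mY Xi Yi XY; apply: ae_le_of_integral_le => //.
by apply: XY; exact: measurable_wrt_lt.
Qed.

(** With [c] the mean, the event where [X] exceeds [c] has probability 0 or 1. Over it [X] and [c]
    have equal integrals, both 0 in the first case and both [c] in the second, so
    [ae_le_of_integral_le] applies. *)
Lemma trivial_sigma_algebra_ae_le_integral (X : T -> R) :
  trivial_sigma_algebra P G -> measurable_wrt G X ->
  P.-integrable setT (EFin \o X) ->
  \forall w \ae P, ((X w)%:E <= \int[P]_x (X x)%:E)%E.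
Proof.
move=> trivG mX Xi; pose c := fine (\int[P]_x (X x)%:E).
have cE : (\int[P]_x (X x)%:E = c%:E)%E.
  by rewrite fineK//; exact: integrable_fin_num Xi.
have mc : measurable_wrt G (cst c) by exact: measurable_cst.
have ci : P.-integrable setT (EFin \o cst c).
  exact: (finite_measure_integrable_cst P c).
rewrite cE; suff : \forall w \ae P, X w <= c by apply: filterS.
apply: (ae_le_of_integral_le Xi ci).
set E := [set x | _]; have GE : G E by exact: measurable_wrt_lt mc mX.
have mE := hG.2 _ GE.
case: (trivG _ GE) => PE.
  have mX' := measurable_int _ Xi.
  have mc' := measurable_int _ ci.
  rewrite (null_set_integral mE (measurable_funTS mX') PE).
  by rewrite (null_set_integral mE (measurable_funTS mc') PE).
have PC : (P (~` E) = 0)%E by rewrite probability_setC// PE -EFinB subrr.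
have EE : E = setT `\` ~` E by rewrite setTD setCK.
have mCE : measurable (~` E) by exact: measurableC.
rewrite EE -(negligible_integral mCE _ Xi PC)// -(negligible_integral mCE _ ci PC)//.
rewrite cE [leRHS](_ : _ = (\int[P]_x (cst c%:E) x)%E)//.
by rewrite integral_cst// [X in (_ * X)%E]probability_setT mule1.
Qed.

End sub_sigma_algebra.

(** * Backward induction, level sets of stopping times, and the Bellman recursion *)

Lemma downward_ind (J : nat) (Q : nat -> Prop) :
  Q J -> (forall j, (j < J)%N -> Q j.+1 -> Q j) -> forall j, (j <= J)%N -> Q j.
Proof.
move=> QJ QS j jJ; rewrite -(subKn jJ); elim: (J - j)%N (leq_subr j J) => [|n IH] nJ.
  by rewrite subn0.
apply: QS; first by rewrite ltn_subrL (leq_ltn_trans _ nJ).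
by rewrite subnSK//; apply: IH; exact: ltnW.
Qed.

(** A level set is the difference of two consecutive sublevel sets, the smaller one lying in [F k]
    by monotonicity of the filtration; [k = 0] has no predecessor. *)
Lemma stopping_time_eq_set d (T : measurableType d) (F : nat -> set (set T))
    (J j k : nat) (sigma : T -> nat) :
  filtration F J -> stopping_time F J j sigma -> (k <= J)%N ->
  F k [set w | sigma w = k].
Proof.
move=> hF [_ st] kJ; have Fk := hF.1 _ kJ.
case: k kJ Fk => [|k] kJ Fk.
  rewrite (_ : [set w | _] = [set w | (sigma w <= 0)%N]); first exact: st.
  by apply/seteqP; split=> w /=; [move=> ->|rewrite leqn0 => /eqP].
rewrite (_ : [set w | _] =
    [set w | (sigma w <= k.+1)%N] `\` [set w | (sigma w <= k)%N]).
  apply: sub_sigmaD => //; first exact: st.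
  by apply: (hF.2 k); [rewrite leqnSn kJ|exact/st/ltnW].
apply/seteqP; split=> w /=; first by move=> ->; rewrite ltnn.
by move=> [s1 /negP]; rewrite -ltnNge => s2; apply/eqP; rewrite eqn_leq s1.
Qed.

Section bellman.
Context (T : Type) (R : realType) (J : nat) (Z C : nat -> T -> R).

(* At j = J there is no continuation: the convention Y J.+1 = 0 must not compete
   with a negative reward Z J. *)
Definition bellman (j : nat) (w : T) : R :=
  if (j < J)%N then Num.max (Z j w) (C j w) else Z j w.

(** Starting the search at [j] gives the backward induction a time for each stage. An unsuccessful
    [find] returns the length [J - j], so for [j <= J] the value is then [J]. *)
Definition first_optimal_time_from (j : nat) (w : T) : nat :=
  (j + find (fun i => (C i w <= Z i w)%R) (iota j (J - j)))%N.

Lemma first_optimal_time_from0 :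
  first_optimal_time_from 0 = first_optimal_time J Z C.
Proof. by apply/funext => w; rewrite /first_optimal_time_from add0n subn0. Qed.

Lemma first_optimal_time_from_step j w : (j < J)%N ->
  first_optimal_time_from j w =
  if C j w <= Z j w then j else first_optimal_time_from j.+1 w.
Proof.
move=> jJ; rewrite /first_optimal_time_from -(subnSK jJ) /=.
by case: ifP => _; rewrite ?addn0// addSnnS.
Qed.

Lemma first_optimal_time_from_last w : first_optimal_time_from J w = J.
Proof. by rewrite /first_optimal_time_from subnn addn0. Qed.

End bellman.

(** * Bellman equation for the Snell envelope, and optional stopping *)

Section optimal_stopping.
Context d (T : measurableType d) (R : realType) (P : probability T R).
Context (J : nat) (F : nat -> set (set T)) (Z Y C : nat -> T -> R).
Hypotheses (hF : filtration F J)
  (hZa : adapted F J Z) (hZi : integrable_process P J Z)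
  (hY : snell_envelope P F J Z Y) (hC : continuation_value P F J Y C).

Local Notation V := (bellman J Z C).
Local Notation tau_ := (first_optimal_time_from J Z C).

Let measurable_filtration j A : (j <= J)%N -> F j A -> measurable A.
Proof. by move=> jJ; exact: (hF.1 _ jJ).2. Qed.

(** Backward induction: for [k >= j] the sublevel set consists of the event [C j <= Z j], which lies
    in [F j] and so in [F k], and of the sublevel set of the next stage outside that event. For
    [k < j] it is empty. *)
Lemma stopping_time_first_optimal_from j : (j <= J)%N ->
  stopping_time F J j (tau_ j).
Proof.
move=> jJ; split => [w|].
  rewrite leq_addr -[leqRHS](subnKC jJ) leq_add2l.
  by rewrite -[leqRHS](size_iota j) find_size.
move: j jJ; apply: downward_ind => [k kJ|j jJ IH k kJ].
  have [Jk|kJ'] := leqP J k.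
    rewrite (_ : [set w | _] = setT); first exact: sub_sigmaT (hF.1 _ kJ).
    by apply/seteqP; split=> // w _ /=; rewrite first_optimal_time_from_last.
  rewrite (_ : [set w | _] = set0); first by have [[]] := hF.1 _ kJ.
  by apply/seteqP; split=> // w /=; rewrite first_optimal_time_from_last leqNgt kJ'.
have [jk|kj] := leqP j k; last first.
  rewrite (_ : [set w | _] = set0); first by have [[]] := hF.1 _ kJ.
  apply/seteqP; split=> // w /=; rewrite leqNgt (leq_trans kj)//.
  exact: leq_addr.
have FB : F k [set w | C j w <= Z j w].
  apply: (hF.2 j); first by rewrite jk.
  have jJ' := ltnW jJ.
  by apply: (measurable_wrt_le (hF.1 _ jJ') _ (hZa jJ')); case: (hC jJ').
rewrite (_ : [set w | _] = [set w | C j w <= Z j w] `|`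
    ([set w | (tau_ j.+1 w <= k)%N] `\` [set w | C j w <= Z j w])).
  have Fk := hF.1 _ kJ.
  by apply: sub_sigmaU => //; apply: sub_sigmaD => //; exact: IH.
apply/seteqP; split=> w /=; rewrite (first_optimal_time_from_step Z C w jJ).
  by case: ifP => h; [left|right].
by case: ifP => // h [|[]].
Qed.

Lemma measurable_wrt_continuation j : (j <= J)%N -> measurable_wrt (F j) (C j).
Proof. by move=> jJ; case: (hC jJ). Qed.

Lemma integrable_continuation j : (j <= J)%N -> P.-integrable setT (EFin \o C j).
Proof. by move=> jJ; case: (hC jJ). Qed.

Lemma measurable_wrt_bellman j : (j <= J)%N -> measurable_wrt (F j) (V j).
Proof.
move=> jJ; rewrite /bellman; case: (j < J)%N; last exact: hZa.
by apply: measurable_maxr; [exact: hZa|exact: measurable_wrt_continuation].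
Qed.

Lemma integrable_bellman j : (j <= J)%N -> P.-integrable setT (EFin \o V j).
Proof.
move=> jJ; rewrite /bellman; case: (j < J)%N; last exact: hZi.
by apply: integrable_maxr; [exact: hZi|exact: integrable_continuation].
Qed.

Lemma integrable_stopped j sigma (X : nat -> T -> R) :
  stopping_time F J j sigma -> integrable_process P J X ->
  P.-integrable setT (EFin \o (fun w => X (sigma w) w)).
Proof.
move=> st Xi; apply: (@integrable_random_index _ _ _ _ J) => // [w|k kJ].
  by case/andP: (st.1 w).
by apply: (measurable_filtration kJ); exact: stopping_time_eq_set st kJ.
Qed.

(** The first hypothesis makes [V j] a version of the conditional reward of [tau_ j], hence a member
    of the family under the essential supremum; the second makes it an upper bound of that
    family. *)
Lemma snell_envelope_eq_bellman j : (j <= J)%N ->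
  (forall A, F j A ->
    (\int[P]_(w in A) (Z (tau_ j w) w)%:E =
     \int[P]_(w in A) (V j w)%:E)%E) ->
  (forall sigma A, stopping_time F J j sigma -> F j A ->
    (\int[P]_(w in A) (Z (sigma w) w)%:E <=
     \int[P]_(w in A) (V j w)%:E)%E) ->
  \forall w \ae P, Y j w = V j w.
Proof.
move=> jJ attained bound; have Fj := hF.1 _ jJ.
have [_ /(_ _ jJ)[_ Yub Ylub] _] := hY.
have mV := measurable_wrt_bellman jJ; have Vi := integrable_bellman jJ.
have Vle : \forall w \ae P, V j w <= Y j w.
  apply: Yub; exists (tau_ j).
    exact: stopping_time_first_optimal_from.
  split => // [|A FA]; last by rewrite attained.
  exact: integrable_stopped (stopping_time_first_optimal_from jJ) hZi.
have Vge : \forall w \ae P, Y j w <= V j w.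
  apply: Ylub; first exact: measurable_wrt_measurable Fj _ mV.
  move=> W [sigma st [_ mW Wi WE]].
  apply: (ae_le_of_sub_sigma_integral Fj) => // A FA.
  by rewrite WE//; exact: bound.
by apply: filterS2 Vle Vge => w V1 V2; apply/eqP; rewrite eq_le V1 V2.
Qed.

(** Both halves go through the induction together: the step at [j] replaces [Y j.+1] by [V j.+1],
    and this equality uses attainment and domination at [j.+1]. *)
Lemma bellman_integrals j : (j <= J)%N ->
  (forall A, F j A ->
    (\int[P]_(w in A) (Z (tau_ j w) w)%:E =
     \int[P]_(w in A) (V j w)%:E)%E) /\
  (forall sigma A, stopping_time F J j sigma -> F j A ->
    (\int[P]_(w in A) (Z (sigma w) w)%:E <=
     \int[P]_(w in A) (V j w)%:E)%E).
Proof.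
move: j; apply: downward_ind => [|j jJ [attained bound]].
  split => [A FA|sigma A st FA].
    apply: eq_integral => w _.
    by rewrite first_optimal_time_from_last /bellman ltnn.
  rewrite le_eqVlt; apply/orP; left; apply/eqP; apply: eq_integral => w _.
  rewrite /bellman ltnn (_ : sigma w = J)//; apply/eqP.
  by rewrite eqn_leq andbC; exact: st.1.
have jJ' := ltnW jJ; have Fj := hF.1 _ jJ'.
have YV := snell_envelope_eq_bellman jJ attained bound.
have [Yi mC Ci CE] := hC jJ'.
have Vi := integrable_bellman jJ.
have FjS A : F j A -> F j.+1 A by apply: hF.2; rewrite leqnSn.
(* [C j] conditions [Y j.+1]; the induction hypothesis lets [V j.+1] take its place under the
   integral. *)
have contE A : F j A ->
    (\int[P]_(w in A) (V j.+1 w)%:E = \int[P]_(w in A) (C j w)%:E)%E.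
  move=> FA; rewrite CE//; have mA := measurable_filtration jJ' FA.
  apply: ae_eq_integral => //.
  - by apply: measurable_funTS; exact: measurable_int Vi.
  - by apply: measurable_funTS; exact: measurable_int Yi.
  - by apply: filterS YV => w /= -> _.
have V0i := integrable_bellman jJ'.
have mbell A : measurable_fun A (EFin \o V j).
  by apply: measurable_funTS; exact: measurable_int V0i.
have iS X A : measurable A -> P.-integrable setT (EFin \o X) ->
    P.-integrable A (EFin \o X).
  by move=> mA; exact: integrableS.
split => [A FA|sigma A st FA]; have mA := measurable_filtration jJ' FA.
  (* Attainment: where [C j <= Z j], stopping is immediate and [V j = Z j]; elsewhere [tau_ j]
     continues as [tau_ j.+1] and [V j = C j]. *)
  have FB : F j [set w | C j w <= Z j w].
    by apply: (measurable_wrt_le Fj mC); exact: hZa.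
  have mB := measurable_filtration jJ' FB.
  have Zti := integrable_stopped (stopping_time_first_optimal_from jJ') hZi.
  rewrite (integral_setID _ mA mB); last first.
    by apply: measurable_funTS; exact: measurable_int Zti.
  rewrite [RHS](integral_setID _ mA mB)//; congr (_ + _)%E.
    apply: eq_integral => w /set_mem[_ /= ZC].
    rewrite (first_optimal_time_from_step Z C w jJ) ZC.
    by rewrite /bellman jJ (max_idPl ZC).
  have FAB : F j (A `\` [set w | C j w <= Z j w]) by exact: sub_sigmaD.
  transitivity (\int[P]_(w in A `\` [set w | (C j w <= Z j w)%R]) (C j w)%:E)%E.
    rewrite -contE// -attained; last exact: FjS.
    apply: eq_integral => w /set_mem[_ /= /negP/negbTE ZC].
    by rewrite (first_optimal_time_from_step Z C w jJ) ZC.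
  apply: eq_integral => w /set_mem[_ /= /negP]; rewrite -ltNge => /ltW ZC.
  by rewrite /bellman jJ (max_idPr ZC).
(* Domination: as [sigma >= j], this event is [sigma = j], where the reward is [Z j <= V j]. Off it
   the bound passes through [C j <= V j]. *)
have FB : F j [set w | (sigma w <= j)%N] by exact: st.2.
have mB := measurable_filtration jJ' FB.
have Zsi := integrable_stopped st hZi.
rewrite (integral_setID _ mA mB); last first.
  by apply: measurable_funTS; exact: measurable_int Zsi.
rewrite [leRHS](integral_setID _ mA mB)//; apply: leeD.
  apply: le_integral; first exact: measurableI.
  - by apply: (iS _ _ _ Zsi); exact: measurableI.
  - by apply: (iS _ _ _ V0i); exact: measurableI.
  move=> w /set_mem[_ /= sj]; have {sj}-> : sigma w = j.
    by apply/eqP; rewrite eqn_leq sj; case/andP: (st.1 w).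
  by rewrite lee_fin /bellman jJ le_max lexx.
have FAB : F j (A `\` [set w | (sigma w <= j)%N]) by exact: sub_sigmaD.
have mAB := measurable_filtration jJ' FAB.
(* The induction hypothesis needs a time with values from [j.+1] on; the maximum with [j.+1] is one
   and agrees with [sigma] where [sigma > j]. *)
have st' : stopping_time F J j.+1 (fun w => maxn (sigma w) j.+1).
  split=> [w|k kJ]; first by rewrite leq_maxr geq_max jJ; case/andP: (st.1 w) => _ ->.
  have [jk|kj] := ltnP j k.
    rewrite (_ : [set w | _] = [set w | (sigma w <= k)%N]); first exact: st.2.
    by apply/seteqP; split=> w /=; rewrite geq_max jk andbT.
  rewrite (_ : [set w | _] = set0); first by have [[]] := hF.1 _ kJ.
  by apply/seteqP; split=> w //=; rewrite geq_max ltnNge kj andbF.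
apply: (@le_trans _ _ (\int[P]_(w in A `\` [set w | (sigma w <= j)%N]) (C j w)%:E)%E).
  rewrite -contE//; apply: le_trans (bound _ _ st' (FjS _ FAB)).
  rewrite le_eqVlt; apply/orP; left; apply/eqP.
  apply: eq_integral => w /set_mem[_ /= /negP].
  by rewrite -ltnNge => /maxn_idPl ->.
apply: le_integral; [by []|exact: (iS _ _ _ Ci)|exact: (iS _ _ _ V0i)|move=> w _].
by rewrite lee_fin /bellman jJ le_max lexx orbT.
Qed.

Lemma snell_envelope_bellman j : (j <= J)%N ->
  \forall w \ae P, Y j w = V j w.
Proof.
move=> jJ; have [attained bound] := bellman_integrals jJ.
exact: snell_envelope_eq_bellman.
Qed.

(** For positive indices integrability is part of [continuation_value]; index 0 conditions nothing
    and inherits it from [V 0] through almost-everywhere equality. *)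
Lemma integrable_snell_envelope0 : P.-integrable setT (EFin \o Y 0%N).
Proof.
have Vi := integrable_bellman (leq0n J).
have mY : measurable_fun setT (Y 0%N).
  have [Ya _ _] := hY.
  exact: measurable_wrt_measurable (hF.1 _ (leq0n J)) _ (Ya _ (leq0n J)).
apply/integrableP; split; first exact/measurable_EFinP.
have [mV] := integrableP _ _ _ Vi; congr (_ < _)%E; apply: ae_eq_integral => //.
- exact: measurableT_comp.
- by apply: measurableT_comp => //; exact/measurable_EFinP.
by apply: filterS (snell_envelope_bellman (leq0n J)) => w /= -> _.
Qed.

(** On the event [sigma = k] of [F k], [S k] and [S J] have the same integral; summing over [k]
    gives the mean of [S J], which is that of [S 0]. *)
Lemma optional_stopping (S : nat -> T -> R) (sigma : T -> nat) :
  martingale P F J S -> stopping_time F J 0 sigma ->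
  (\int[P]_w (S (sigma w) w)%:E = \int[P]_w (S 0%N w)%:E)%E.
Proof.
move=> [Sa Si Sc] st.
have sJ w : (sigma w <= J)%N by case/andP: (st.1 w).
have msigma k : (k <= J)%N -> measurable [set w | sigma w = k].
  by move=> kJ; apply: (measurable_filtration kJ); exact: stopping_time_eq_set st kJ.
have SJ : forall k, (k <= J)%N -> forall A, F k A ->
    (\int[P]_(w in A) (S k w)%:E = \int[P]_(w in A) (S J w)%:E)%E.
  apply: downward_ind => // k kJ IH A FA; have [_ _ _ ->//] := Sc _ kJ.
  by apply: IH; apply: hF.2 FA; rewrite leqnSn.
have F0T : F 0%N setT by exact: sub_sigmaT (hF.1 _ (leq0n J)).
rewrite (integral_random_index sJ msigma Si) SJ//.
(* Reading [S J] as a process constant in its index splits its integral along the same level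
   sets. *)
rewrite (integral_random_index (X := fun=> S J) sJ msigma); last by move=> k _; exact: Si.
apply: eq_bigr => k _; have kJ : (k <= J)%N by rewrite -ltnS.
by rewrite SJ//; exact: stopping_time_eq_set st kJ.
Qed.

End optimal_stopping.

(** * Deterministic analysis of the duality gap along one path *)

Section pathwise.
Context (R : realType) (T : Type) (J : nat) (Z Y C : nat -> T -> R) (w : T).

Let tau := first_optimal_time J Z C w.
Let A := doob_compensator Y C.

Definition duality_gap (j : nat) : R := Y j w - Z j w + A j w.

(** In the martingale minus the compensator the terms [C l] cancel and the rest telescopes to
    [Y j - Y 0]; this is pure algebra, valid on every path. *)
Lemma reward_sub_doob_martingale j :
  Z j w - doob_martingale Y C j w = Y 0%N w - duality_gap j.
Proof.
suff : doob_martingale Y C j w = Y j w - Y 0%N w + A j w by rewrite /duality_gap; lra.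
rewrite /doob_martingale /A /doob_compensator.
elim: j => [|j IH]; first by rewrite !big_ord0 subrr addr0.
by rewrite !big_ord_recr /= IH; lra.
Qed.

Lemma first_optimal_time_le : (tau <= J)%N.
Proof. by rewrite -[leqRHS](size_iota 0) find_size. Qed.

Lemma reward_lt_continuation j : (j < tau)%N -> Z j w < C j w.
Proof.
move=> jt; have jJ := leq_trans jt first_optimal_time_le.
by have := before_find 0%N jt; rewrite nth_iota// add0n => /negbT; rewrite -ltNge.
Qed.

Lemma continuation_le_reward : (tau < J)%N -> C tau w <= Z tau w.
Proof.
move=> tJ; have : has (fun i => C i w <= Z i w) (iota 0 J) by rewrite has_find size_iota.
by move=> /(nth_find 0%N); rewrite nth_iota.
Qed.

Hypothesis YE : forall j, (j <= J)%N -> Y j w = bellman J Z C j w.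

Let reward_le_snell j : (j <= J)%N -> Z j w <= Y j w.
Proof.
by move=> jJ; rewrite YE// /bellman; case: ifP => // _; rewrite le_max lexx.
Qed.

Let continuation_le_snell j : (j < J)%N -> C j w <= Y j w.
Proof.
by move=> jJ; rewrite (YE (ltnW jJ)) /bellman jJ le_max lexx orbT.
Qed.

Let snell_eq_continuation j : (j < tau)%N -> Y j w = C j w.
Proof.
move=> jt; have jJ := leq_trans jt first_optimal_time_le.
by rewrite (YE (ltnW jJ)) /bellman jJ; apply/max_idPr/ltW; exact: reward_lt_continuation.
Qed.

Let snell_eq_reward : Y tau w = Z tau w.
Proof.
rewrite (YE first_optimal_time_le) /bellman; case: ifP => // tJ.
exact/max_idPl/continuation_le_reward.
Qed.

Let compensator_ge0 j : (j <= J)%N -> 0 <= A j w.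
Proof.
move=> jJ; apply: sumr_ge0 => l _; rewrite subr_ge0 continuation_le_snell//.
exact: leq_trans jJ.
Qed.

Let compensator_first_optimal_time : A tau w = 0.
Proof.
by rewrite /A /doob_compensator big1// => l _; rewrite snell_eq_continuation ?subrr.
Qed.

Lemma duality_gap_ge0 j : (j <= J)%N -> 0 <= duality_gap j.
Proof.
by move=> jJ; rewrite /duality_gap addr_ge0 ?compensator_ge0// subr_ge0 reward_le_snell.
Qed.

Lemma duality_gap_first_optimal_time : duality_gap tau = 0.
Proof. by rewrite /duality_gap compensator_first_optimal_time snell_eq_reward subrr addr0. Qed.

(** Before [tau] the reward lies strictly below [C j = Y j]; after [tau] the compensator already
    contains the positive increment [Y tau - C tau]. *)
Lemma duality_gap_gt0 j : C tau w < Y tau w -> (j <= J)%N -> j != tau ->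
  0 < duality_gap j.
Proof.
move=> strict jJ; rewrite neq_ltn => /orP[jt|tj].
  rewrite /duality_gap ltr_pwDl ?compensator_ge0// subr_gt0 snell_eq_continuation//.
  exact: reward_lt_continuation.
rewrite /duality_gap ltr_wpDl ?subr_ge0 ?reward_le_snell//.
rewrite /A /doob_compensator (bigD1 (Ordinal tj))//= ltr_pwDl ?subr_gt0//.
apply: sumr_ge0 => l _; rewrite subr_ge0 continuation_le_snell//.
exact: leq_trans jJ.
Qed.

End pathwise.

(** * Finite maxima and almost-sure statements over finitely many indices *)

Lemma le_max_upto (R : realType) (J j : nat) (x : nat -> R) :
  (j <= J)%N -> x j <= max_upto J x.
Proof.
by move=> jJ; apply: (@le_bigmax _ _ _ (x 0%N) (fun i : 'I_J.+1 => x i) (Ordinal _)).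
Qed.

Lemma max_upto_le (R : realType) (J : nat) (x : nat -> R) (c : R) :
  (forall j, (j <= J)%N -> x j <= c) -> max_upto J x <= c.
Proof.
move=> xc; apply: bigmax_le; first exact: xc.
by move=> j _; apply: xc; rewrite -ltnS.
Qed.

Lemma ae_forall_le d (T : measurableType d) (R : realType) (P : probability T R)
    (J : nat) (Q : nat -> T -> Prop) :
  (forall j, (j <= J)%N -> \forall w \ae P, Q j w) ->
  \forall w \ae P, forall j, (j <= J)%N -> Q j w.
Proof.
move=> PQ; apply: (ae_foralln (P := fun j w => (j <= J)%N -> Q j w)) => j.
have [/PQ|_] := leqP j J; first by apply: filterS.
exact: aeW.
Qed.

(** * Transfer to the extended space, and centered perturbations on it *)

Section extension.
Context d d0 (T : measurableType d) (T0 : measurableType d0) (R : realType).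
Context (P : probability T R) (Pt : probability (T * T0)%type R).
Hypothesis hPt : extends P Pt.

Let preimage_fst (A : set T) : fst @^-1` A = A `*` [set: T0].
Proof. by apply/seteqP; split=> [[x y]|[x y] []]. Qed.

Let measurable_preimage_fst (A : set T) :
  measurable A -> measurable (fst @^-1` A : set (T * T0)).
Proof. by move=> mA; rewrite -[X in measurable X]setTI; exact: measurable_fst. Qed.

Let measure_preimage_fst (A : set T) : measurable A -> Pt (fst @^-1` A) = P A.
Proof. by move=> mA; rewrite -hPt//; congr (Pt _); exact: preimage_fst. Qed.

Lemma ae_extends (Q : T -> Prop) :
  (\forall w \ae P, Q w) -> \forall w \ae Pt, Q w.1.
Proof.
move=> [N [mN PN QN]]; exists (fst @^-1` N); split.
- exact: measurable_preimage_fst.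
- by rewrite measure_preimage_fst.
- by move=> w; exact: QN.
Qed.

(** [P] is the image of [Pt] under [fst], so this is a change of variables. *)
Lemma integrable_extends (f : T -> R) :
  P.-integrable setT (EFin \o f) ->
  Pt.-integrable setT (EFin \o (fun w => f w.1)).
Proof.
move=> /integrableP[mf fi]; apply/integrableP; split.
  exact: (measurableT_comp mf measurable_fst).
rewrite (_ : (\int[Pt]_x _ = \int[P]_x `|(f x)%:E|)%E)//.
rewrite -(eq_measure_integral P (m1 := pushforward Pt fst)).
  rewrite (ge0_integral_pushforward measurable_fst)//.
  exact: measurableT_comp.
by move=> A mA _; exact: measure_preimage_fst.
Qed.

Lemma integral_extends (f : T -> R) (A : set T) : measurable A ->
  P.-integrable setT (EFin \o f) ->
  (\int[Pt]_(w in fst @^-1` A) (f w.1)%:E = \int[P]_(w in A) (f w)%:E)%E.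
Proof.
move=> mA fi; have mf := measurable_int _ fi.
rewrite -(eq_measure_integral P (m1 := pushforward Pt fst)).
  rewrite (integral_pushforward measurable_fst mf)//.
  apply: (integrableS measurableT) => //; first exact: measurable_preimage_fst.
  exact: integrable_extends.
by move=> B mB _; exact: measure_preimage_fst.
Qed.

(** Each event [sigma w.1 = k] belongs to the lifted sigma-algebra, so conditional centering makes
    [eta k] integrate to 0 over it. *)
Lemma centered_random_index (J : nat) (eta : nat -> T * T0 -> R) (sigma : T -> nat) :
  centered Pt J eta -> (forall w, (sigma w <= J)%N) ->
  (forall k, (k <= J)%N -> measurable [set w | sigma w = k]) ->
  Pt.-integrable setT (EFin \o (fun w => eta (sigma w.1) w)) /\
  (\int[Pt]_w (eta (sigma w.1) w)%:E = 0)%E.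
Proof.
move=> ceta sJ msigma.
have sJ' (w : T * T0) : (sigma w.1 <= J)%N by exact: sJ.
have ms k : (k <= J)%N -> measurable [set w : T * T0 | sigma w.1 = k].
  by move=> kJ; exact: measurable_preimage_fst (msigma _ kJ).
have ei k : (k <= J)%N -> Pt.-integrable setT (EFin \o eta k).
  by move=> kJ; have [] := ceta _ kJ.
split; first exact: integrable_random_index sJ' ms ei.
rewrite (integral_random_index sJ' ms ei) big1// => k _.
have kJ : (k <= J)%N by rewrite -ltnS.
have [_ _ _ <-] := ceta _ kJ; first exact: integral0.
by exists [set w | sigma w = k]; [exact: msigma|rewrite -preimage_fst].
Qed.

(** Independence says that [Pt] restricted to [G] and pushed forward along [fst] is [P] scaled by
    [Pt G]. *)
Lemma integral_independent (G : set (T * T0)) (mG : measurable G) :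
  (forall A, measurable A -> Pt (G `&` (A `*` setT)) = (Pt G * P A)%E) ->
  forall (A : set T) (g : T -> R), measurable A -> measurable_fun setT g ->
  (forall w, 0 <= g w) ->
  (\int[Pt]_(w in fst @^-1` A `&` G) (g w.1)%:E =
   Pt G * \int[P]_(w in A) (g w)%:E)%E.
Proof.
move=> indep A g mA mg g0; have mgA : measurable_fun A (EFin \o g).
  by apply/measurable_EFinP; exact: measurable_funTS.
have PtG : Pt G \is a fin_num by exact: fin_num_measure.
pose k : {nonneg R} := NngNum (fine_ge0 (measure_ge0 Pt G)).
have kE : Pt G = (k%:num)%:E by rewrite /= fineK.
rewrite -(integral_mrestr Pt mG); last 2 first.
- exact: measurable_preimage_fst.
- apply: measurable_funTS; apply/measurable_EFinP.
  exact: (measurableT_comp mg measurable_fst).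
transitivity (\int[pushforward (mrestr Pt mG) fst]_(w in A) (g w)%:E)%E.
  rewrite (ge0_integral_pushforward measurable_fst)//.
  by move=> w _; rewrite lee_fin.
rewrite (eq_measure_integral (mscale k P)) => [|B mB _]; last first.
  transitivity (Pt (G `&` (B `*` setT))); last by rewrite indep// kE.
  by congr (Pt _); rewrite setIC -preimage_fst.
by rewrite kE ge0_integral_mscale// => w _; rewrite lee_fin.
Qed.

(** Over a lifted event, [\1_G * g j] and [Pt G * g j] have the same integral by
    [integral_independent]; the bounds on [g] supply positivity and integrability. *)
Lemma centered_independent (J : nat) (G : set (T * T0)) (g : nat -> T -> R) :
  measurable G ->
  (forall A, measurable A -> Pt (G `&` (A `*` setT)) = (Pt G * P A)%E) ->
  (forall j, (j <= J)%N -> measurable_fun setT (g j)) ->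
  (forall j w, 0 <= g j w <= 1) ->
  centered Pt J (fun j w => (\1_G w - fine (Pt G)) * g j w.1).
Proof.
move=> mG indep mg g01 j jJ; set p := fine (Pt G).
have PtG : Pt G \is a fin_num by exact: fin_num_measure.
have gi : P.-integrable setT (EFin \o g j).
  have oi : P.-integrable setT (EFin \o cst 1) :=
    finite_measure_integrable_cst P 1 measurableT.
  apply: (le_integrable measurableT _ _ oi).
    by apply/measurable_EFinP; exact: mg.
  by move=> w _ /=; have /andP[g0 g1] := g01 j w; rewrite lee_fin !ger0_norm.
have gti := integrable_extends gi.
have mgt : measurable_fun setT (fun w : T * T0 => g j w.1).
  exact: (measurableT_comp (mg _ jJ) measurable_fst).
have Ggi : Pt.-integrable setT (EFin \o (fun w => \1_G w * g j w.1)).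
  apply: (le_integrable measurableT _ _ gti).
    by apply/measurable_EFinP; apply: measurable_funM => //; exact: measurable_indic.
  move=> w _ /=; rewrite lee_fin normrM ler_piMl// indicE.
  by case: (_ \in _); rewrite ?normr1 ?normr0.
have pgi : Pt.-integrable setT (EFin \o (fun w => p * g j w.1)).
  exact: (integrableZl measurableT p gti).
split.
- apply: eq_integrable (integrableB measurableT Ggi pgi) => //= w _.
  by rewrite mulrBl.
- exact: measurable_cst.
- exact: (integrable0 Pt setT).
move=> _ [A mA <-]; rewrite -preimage_fst integral0.
have mA' := measurable_preimage_fst mA.
transitivity (\int[Pt]_(w in fst @^-1` A)
    ((\1_G w * g j w.1)%:E - (p * g j w.1)%:E))%E; last first.
  by apply: eq_integral => w _; rewrite -EFinB -mulrBl.
rewrite integralB_EFin//; last 2 first.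
- exact: integrableS Ggi.
- exact: integrableS pgi.
have -> : (\int[Pt]_(w in fst @^-1` A) (\1_G w * g j w.1)%:E =
    \int[Pt]_(w in fst @^-1` A `&` G) (g j w.1)%:E)%E.
  rewrite integral_mkcondr; apply: eq_integral => w _.
  by rewrite patchE indicE; case: (_ \in _); rewrite ?mul1r ?mul0r.
rewrite (integral_independent mG indep mA (mg _ jJ)); last first.
  by move=> w; case/andP: (g01 j w).
under [X in (_ - X)%E]eq_integral do rewrite EFinM.
rewrite integralZl//; last exact: integrableS gti.
rewrite integral_extends// -[Pt G]fineK// -/p.
have : (\int[P]_(w in A) (g j w)%:E)%E \is a fin_num.
  by apply: integrable_fin_num => //; exact: integrableS gi.
by move=> fi; rewrite subee// fin_numM.
Qed.

End extension.

(** * Duality inequality, almost sure identity, and uniqueness of the forced zero *)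

Theorem proposition3p1 (R : realType) (d d0 : measure_display)
    (T : measurableType d) (T0 : measurableType d0)
    (P : probability T R) (Pt : probability (T * T0)%type R)
    (J : nat) (F : nat -> set (set T))
    (Z Y C : nat -> T -> R) (eta : nat -> T * T0 -> R)
    (hJ : (0 < J)%N)
    (hF : filtration F J)
    (hF0 : trivial_sigma_algebra P (F 0%N))
    (hZa : adapted F J Z)
    (hZi : integrable_process P J Z)
    (hY : snell_envelope P F J Z Y)
    (hC : continuation_value P F J Y C)
    (hPt : extends P Pt)
    (heta : centered Pt J eta) :
  let M := doob_martingale Y C in
  let A := doob_compensator Y C in
  let tau := first_optimal_time J Z C in
  (forall S : nat -> T -> R,
     martingale P F J S ->
     (\forall w \ae P, S 0%N w = 0) ->
     \forall w0 \ae P,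
       ((Y 0%N w0)%:E <=
        'E_Pt[fun w => max_upto J
                 (fun j => Z j w.1 - (M j w.1 - S j w.1 - eta j w))%R])%E) /\
  (perturbation_bound Pt J Z Y A eta ->
   [/\ \forall w \ae Pt,
         Y 0%N w.1 = max_upto J (fun j => Z j w.1 - (M j w.1 - eta j w)),
       \forall w \ae Pt, eta (tau w.1) w = 0 &
       (\forall w \ae P, 0 < Y (tau w) w - C (tau w) w) ->
       rich_enough P Pt ->
       forall sigma : T * T0 -> nat, random_time J sigma ->
         forced_zero Pt J Z Y A sigma ->
         \forall w \ae Pt, sigma w = tau w.1]).
Proof.
move=> M A tau.
have J0 := leq0n J.
have tauJ w : (tau w <= J)%N by exact: first_optimal_time_le.
have st : stopping_time F J 0 tau.
  rewrite /tau -first_optimal_time_from0.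
  exact: (stopping_time_first_optimal_from hF hZa hC J0).
have mtau k : (k <= J)%N -> measurable [set w | tau w = k].
  by move=> kJ; apply: (hF.1 _ kJ).2; exact: stopping_time_eq_set hF st kJ.
have YV : \forall w \ae P, forall j, (j <= J)%N -> Y j w = bellman J Z C j w.
  by apply: ae_forall_le => j jJ; exact: (snell_envelope_bellman hF hZa hZi hY hC).
have YVt := ae_extends hPt YV.
have Y0i := integrable_snell_envelope0 hF hZa hZi hY hC.
have Yi j : (j <= J)%N -> P.-integrable setT (EFin \o Y j).
  by case: j => [//|j jJ]; have [] := hC _ (ltnW jJ).
have Ci j : (j <= J)%N -> P.-integrable setT (EFin \o C j).
  by move=> jJ; have [] := hC _ jJ.
have [etai eta0] := centered_random_index heta tauJ mtau.
split=> [S hS S0|hstar].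
  have [Sa Si _] := hS.
  have Sti := integrable_stopped hF st Si.
  have ES0 : (\int[P]_w (S (tau w) w)%:E = 0)%E.
    rewrite (optional_stopping hF hS st) -[RHS](integral0 P setT).
    apply: ae_eq_integral => //; first exact: measurable_int (Si _ J0).
    by apply: filterS S0 => w -> _.
  (* [L] is the term of the maximum at [tau], where the duality gap vanishes; its three summands
     have means that of [Y 0], 0 and 0. *)
  pose L w := Y 0%N w.1 + S (tau w.1) w.1 + eta (tau w.1) w.
  pose X j w := Z j w.1 - (M j w.1 - S j w.1 - eta j w).
  have Mi j : (j <= J)%N -> P.-integrable setT (EFin \o M j).
    move=> jJ; rewrite (_ : EFin \o M j =
        fun w => \sum_(l < j) ((Y l.+1 w)%:E - (C l w)%:E))%E.
      apply: integrable_sum => // l _; have lJ := leq_trans (ltn_ord l) jJ.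
      by apply: integrableB => //; [exact: Yi|exact/Ci/ltnW].
    by apply/funext => w /=; rewrite -sumEFin.
  have Y0ti := integrable_extends hPt Y0i.
  have Stti := integrable_extends hPt Sti.
  have Li : Pt.-integrable setT (EFin \o L).
    exact: (integrableD measurableT (integrableD measurableT Y0ti Stti) etai).
  have Xi j : (j <= J)%N -> Pt.-integrable setT (EFin \o X j).
    move=> jJ; have [ei _ _ _] := heta _ jJ.
    have Zti := integrable_extends hPt (hZi _ jJ).
    have Mti := integrable_extends hPt (Mi _ jJ).
    have Sjti := integrable_extends hPt (Si _ jJ).
    exact: (integrableB measurableT Zti
      (integrableB measurableT (integrableB measurableT Mti Sjti) ei)).
  have Wi : Pt.-integrable setT (EFin \o (fun w => max_upto J (X ^~ w))).
    apply: integrable_bigmaxr; first exact: Xi.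
    by move=> i; apply: Xi; rewrite -ltnS.
  have LW : \forall w \ae Pt, setT w -> ((L w)%:E <= (max_upto J (X ^~ w))%:E)%E.
    apply: filterS YVt => w Yw _; rewrite lee_fin.
    have -> : L w = X (tau w.1) w.
      rewrite /L /X; have := reward_sub_doob_martingale Z Y C w.1 (tau w.1).
      by rewrite duality_gap_first_optimal_time// -/M => ?; lra.
    exact: (le_max_upto (X ^~ w)).
  have EL : (\int[Pt]_w (L w)%:E = \int[P]_w (Y 0%N w)%:E)%E.
    have YSi := integrableD measurableT Y0ti Stti.
    transitivity (\int[Pt]_w
        ((Y 0%N w.1)%:E + (S (tau w.1) w.1)%:E + (eta (tau w.1) w)%:E))%E.
      by apply: eq_integral => w _; rewrite /L !EFinD.
    rewrite integralD// integralD// eta0 adde0.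
    have -> : (\int[Pt]_w (S (tau w.1) w.1)%:E = 0)%E.
      by rewrite -ES0 -(integral_extends hPt measurableT Sti) preimage_setT.
    by rewrite adde0 -(integral_extends hPt measurableT Y0i) preimage_setT.
  have [Ya _ _] := hY.
  have F0 := hF.1 _ J0.
  (* Triviality of [F 0] bounds [Y 0] by its mean, which is the mean of [L]. *)
  apply: filterS (trivial_sigma_algebra_ae_le_integral F0 hF0 (Ya _ J0) Y0i) => w0.
  move=> /le_trans; apply; rewrite unlock -EL.
  exact: ae_le_integral Li Wi LW.
(* The perturbation bound unfolds to [eta j <= duality_gap j]; only the quantifier over [j] moves
   inside the almost-sure event. *)
have gap_bound : \forall w \ae Pt, forall j, (j <= J)%N ->
    eta j w <= duality_gap Z Y C w.1 j.
  exact: ae_forall_le hstar.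
have eta_tau0 : \forall w \ae Pt, eta (tau w.1) w = 0.
  have eta_le0 : \forall w \ae Pt, eta (tau w.1) w <= 0.
    apply: filterS2 YVt gap_bound => w Yw /(_ _ (tauJ w.1)).
    by rewrite duality_gap_first_optimal_time.
  exact: ae_eq0_of_le0_integral0 etai eta_le0 eta0.
split=> //.
  apply: filterS3 YVt gap_bound eta_tau0 => w Yw gap e0.
  have XE j : Z j w.1 - (M j w.1 - eta j w) =
      Y 0%N w.1 - duality_gap Z Y C w.1 j + eta j w.
    by have := reward_sub_doob_martingale Z Y C w.1 j; rewrite -/M => ?; lra.
  apply/eqP; rewrite eq_le; apply/andP; split; last first.
    by apply: max_upto_le => j jJ; rewrite XE; have := gap _ jJ; lra.
  have := le_max_upto (fun j => Z j w.1 - (M j w.1 - eta j w)) (tauJ w.1).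
  by rewrite XE e0 duality_gap_first_optimal_time// subr0 addr0.
move=> strict [G [mG G0 G1 indep]] sigma [_ sigmaJ] forced.
(* The gap is nonnegative only almost everywhere, hence the maximum with 0; the minimum with 1 makes
   the perturbation bounded and so integrable. *)
pose g j w := Num.min 1 (Num.max 0 (duality_gap Z Y C w j)).
have mY j : (j <= J)%N -> measurable_fun setT (Y j).
  by move=> jJ; apply/measurable_EFinP; exact: measurable_int (Yi _ jJ).
have mC j : (j <= J)%N -> measurable_fun setT (C j).
  by move=> jJ; apply/measurable_EFinP; exact: measurable_int (Ci _ jJ).
have mZ j : (j <= J)%N -> measurable_fun setT (Z j).
  by move=> jJ; apply/measurable_EFinP; exact: measurable_int (hZi _ jJ).
have mg j : (j <= J)%N -> measurable_fun setT (g j).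
  move=> jJ; apply: measurable_minr => //; apply: measurable_maxr => //.
  apply: measurable_funD; first by apply: measurable_funB; [exact: mY|exact: mZ].
  apply: measurable_sum => l; have lJ := ltnW (leq_trans (ltn_ord l) jJ).
  by apply: measurable_funB; [exact: mY|exact: mC].
have g01 j w : 0 <= g j w <= 1.
  by rewrite /g le_min ler01 le_max lexx/= ge_min lexx.
have ce := centered_independent hPt mG indep mg g01.
have p01 : 0 < fine (Pt G) < 1.
  have PtG : Pt G \is a fin_num by exact: fin_num_measure.
  by rewrite -!lte_fin fineK// G0 G1.
have bound : perturbation_bound Pt J Z Y A
    (fun j w => (\1_G w - fine (Pt G)) * g j w.1).
  move=> j jJ; apply: filterS YVt => w Yw.
  have D0 := duality_gap_ge0 Yw jJ; have /andP[g0 _] := g01 j w.1.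
  have gD : g j w.1 <= duality_gap Z Y C w.1 j.
    by rewrite /g (max_idPr D0) ge_min lexx orbT.
  (* The factor [\1_G - Pt G] is at most 1, so the perturbation stays below [g j], hence below the
     gap. *)
  apply: le_trans gD; apply: ler_piMl => //; rewrite indicE.
  by have /andP[p0 p1] := p01; case: (_ \in _); rewrite ?mulr1n ?mulr0n; lra.
have strict_t := ae_extends hPt strict.
apply: filterS3 YVt strict_t (forced _ ce bound) => w Yw str /eqP.
(* The first factor is [1 - Pt G] or [- Pt G], never 0, so a zero at [sigma] forces [g] to vanish
   there; off [tau] the gap, and with it [g], is positive. *)
rewrite mulf_eq0 => /orP[|/eqP g0].
  rewrite indicE; have /andP[p0 p1] := p01.
  by case: (_ \in _); rewrite ?sub0r ?oppr_eq0 ?subr_eq0 gt_eqF.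
apply/eqP/negPn/negP => sigma_tau.
have CY : C (tau w.1) w.1 < Y (tau w.1) w.1 by rewrite -subr_gt0.
have D0 := duality_gap_gt0 Yw CY (sigmaJ w) sigma_tau.
by move: g0; rewrite /g; apply/eqP; rewrite gt_eqF// lt_min ltr01 lt_max D0 orbT.
Qed.
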